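(* Let $\Lambda,\Gamma$ be rings, $C$ a $\Lambda$-$\Gamma$-bimodule, and $M$ a $\Gamma$-module with a fixed resolution $\cdots\to P_1\xrightarrow{d_1}P_0\to M\to0$ by finitely generated projective $\Gamma$-modules. Let $W$ be a $\Lambda$-module and $\lambda_W\colon W\to M^{\dagger}=\operatorname{Hom}_\Gamma(M,C)$ a homomorphism of $\Lambda$-modules. Let $S$ be a nonempty set and, for each $p\in S$, let $d_p$ be a function assigning to every $\Lambda$-module an element of $\{0,1,2,\dots\}\cup\{\infty\}$, such that $d_p$ satisfies $(\widetilde{d1})$ and (d3) for every $p\in S$. Write $t=t(\lambda_W)\in\{0,1,2,\dots\}\cup\{\infty\}$. Let $C'$ be a direct summand of a finite direct sum of copies of $C$ (as a $\Lambda$-module). Then: (1) $i\le T^{X_{i}(C)}(C')$ for every integer $i$, and $\widetilde{S}^{C}(C')=\infty$. (2) For $0\le i\le2$: if $d'$ is a function from $\Lambda$-modules to $\{0,1,2,\dots\}\cup\{\infty\}$ which satisfies $(\widetilde{d1})$ and $t+i-1\le d'(C'')$ for every direct summand $C''$ of a finite direct sum of copies of $C$, then $t+i-2\le d'(O^{i}(\lambda_{W}))$. (3) $Y^{C}(O^{i}(\lambda_{W}))\subseteq X_{t+i-1}(C)$ for $0\le i\le 2$. (4) $t+i-2\le T^{X_{t+i-1}(C)}(O^{i}(\lambda_{W}))\le\widetilde{S}^{C}(O^{i}(\lambda_{W}))$ for $0\le i\le2$. (5) For $0\le i\le 2$: $t+i-2=T^{X_{t+i-1}(C)}(O^{i}(\lambda_{W}))$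 if and only if $t+i-2=\widetilde{S}^{C}(O^{i}(\lambda_{W}))$.
   Context: Conventions: $\Lambda$-modules are left modules, $\Gamma$-modules are right modules, so $(-)^\dagger=\operatorname{Hom}_\Gamma(-,C)$ takes $\Gamma$-modules to $\Lambda$-modules. Infimum of the empty set is $\infty$, and $\infty+n=\infty$ for every integer $n$. Conditions on a function $d$ from $\Lambda$-modules to $\{0,1,\dots\}\cup\{\infty\}$, required for every short exact sequence $0\to K\to L\to N\to0$ of $\Lambda$-modules: $(\widetilde{d1})$ if $d(L)>d(K)$, then $d(K)\ge d(N)+1$; (d3) if $d(L)<d(N)$, then $d(K)\le d(L)$. Definition of $\mathrm{E}^i$ and $t$: $\mathrm{E}^1(\lambda_W)=\operatorname{Ker}\lambda_W$, $\mathrm{E}^2(\lambda_W)=\operatorname{Coker}\lambda_W$, $\mathrm{E}^i(\lambda_W)=\operatorname{Ext}^{i-2}_\Gamma(M,C)$ for $i\ge3$; and $t(\lambda_W)=\inf\{i\ge0\mid \mathrm{E}^{i+1}(\lambda_W)\ne0\}$. Definition of $O^i$: $O^0(\lambda_W)=\operatorname{Coker}(d_1^\dagger\colon P_0^\dagger\to P_1^\dagger)$, $O^1(\lambda_W)=\operatorname{Im}(d_1^\dagger\colon P_0^\dagger\to P_1^\dagger)$, $O^2(\lambda_W)=W$. For a $\Lambda$-module $N$, a subset $U\subseteq S$, and $i$ an integer or $\infty$: $X_i(N)=\{p\in S\mid i\le d_p(N)\}$; $Y^C(N)=\{p\in S\mid d_p(N)<d_p(C)\}$; $T^U(N)=\inf\{d_p(N)\mid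 p\in U\}$; $\widetilde{S}^C(N)$ is the supremum of the integers $i$ such that $d_p(N)\ge\inf\{i,d_p(C)\}$ for all $p\in S$. *)

(* Defs.v *)
From HB Require Import structures.
From mathcomp Require Import all_boot all_order all_algebra.
From mathcomp Require Import boolp classical_sets constructive_ereal.

Set Implicit Arguments.
Unset Strict Implicit.
Unset Printing Implicit Defensive.

Import Order.TTheory GRing.Theory Num.Theory.

Local Open Scope ring_scope.

(* Left modules over R are [lmodType R]; right modules over R are left modules
   over the converse ring, [lmodType R^c], with x a written [a *: x]. *)

HB.mixin Record Lmodule_hasRightAction (Lam Gam : pzRingType) C
    of GRing.Lmodule Lam C := {
  ract : C -> Gam -> C;
  ractA : forall x a b, ract (ract x a) b = ract x (a * b);
  ract1 : forall x, ract x 1 = x;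
  ractDl : forall x y a, ract (x + y) a = ract x a + ract y a;
  ractDr : forall x a b, ract x (a + b) = ract x a + ract x b;
  ract_scaleA : forall (l : Lam) x a, ract (l *: x) a = l *: ract x a
}.

#[short(type="bimodType")]
HB.structure Definition Bimodule (Lam Gam : pzRingType) :=
  {C of GRing.Lmodule Lam C & Lmodule_hasRightAction Lam Gam C}.

(* The right module underlying a bimodule; an alias, because C itself already
   carries its left module structure. *)
Definition right_mod (Lam Gam : pzRingType) (C : bimodType Lam Gam) : Type := C.

Section RightModule.
Variables (Lam Gam : pzRingType) (C : bimodType Lam Gam).

HB.instance Definition _ := GRing.Zmodule.copy (right_mod C) C.

Let rscale (a : Gam^c) (x : right_mod C) : right_mod C := ract (x : C) a.

Let rscaleA a b x : rscale a (rscale b x) = rscale (a * b) x.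
Proof. exact: ractA. Qed.
Let rscale1 : left_id 1 rscale.
Proof. by move=> x; exact: ract1. Qed.
Let rscaleDr : right_distributive rscale +%R.
Proof. by move=> a x y; exact: ractDl. Qed.
Let rscaleDl x : {morph rscale^~ x : a b / a + b}.
Proof. by move=> a b; exact: ractDr. Qed.

HB.instance Definition _ := GRing.Zmodule_isLmodule.Build Gam^c (right_mod C)
  rscaleA rscale1 rscaleDr rscaleDl.

End RightModule.

(* M^dagger = Hom_Gam(M, C), a left Lam-module through the values. *)
Definition dual (Lam Gam : pzRingType) (C : bimodType Lam Gam)
  (M : lmodType Gam^c) : Type := {linear M -> right_mod C}.

Section Dual.
Variables (Lam Gam : pzRingType) (C : bimodType Lam Gam) (M : lmodType Gam^c).

HB.instance Definition _ := gen_eqMixin (dual C M).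
HB.instance Definition _ := gen_choiceMixin (dual C M).

Implicit Types f g h : dual C M.

Definition dual_apply f : M -> C := (f : {linear M -> right_mod C}).

Lemma dualP f g : dual_apply f =1 dual_apply g -> f = g.
Proof.
rewrite /dual_apply; case: f g => [f [[fA] [fL]]] [g [[gA] [gL]]] /= /funext fg.
move: fA fL gA gL; rewrite {}fg => fA fL gA gL.
by rewrite (Prop_irrelevance fA gA) (Prop_irrelevance fL gL).
Qed.

Definition dual_scale_fun (l : Lam) f : M -> right_mod C :=
  fun x => l *: dual_apply f x.

Lemma dual_scale_is_linear l f : linear (dual_scale_fun l f).
Proof.
move=> a x y; rewrite /dual_scale_fun /dual_apply linearP.
rewrite -[RHS]/(ract (l *: (f x : C)) a + l *: (f y : C)) ract_scaleA.
exact: (scalerDr l (ract (f x : C) a) (f y : C)).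
Qed.

HB.instance Definition _ (l : Lam) f :=
  GRing.isLinear.Build Gam^c M (right_mod C) _ (dual_scale_fun l f)
    (dual_scale_is_linear l f).

Definition dual_zero : dual C M := \0 : {linear M -> right_mod C}.
Definition dual_opp f : dual C M :=
  \- (f : {linear M -> right_mod C}) : {linear M -> right_mod C}.
Definition dual_add f g : dual C M :=
  (f : {linear M -> right_mod C}) \+ (g : {linear M -> right_mod C}).
Definition dual_scale (l : Lam) f : dual C M :=
  dual_scale_fun l f : {linear M -> right_mod C}.

Let dual_addA : associative dual_add.
Proof. by move=> f g h; apply: dualP => x; exact: addrA. Qed.
Let dual_addC : commutative dual_add.
Proof. by move=> f g; apply: dualP => x; exact: addrC. Qed.
Let dual_add0 : left_id dual_zero dual_add.
Proof. by move=> f; apply: dualP => x; exact: add0r. Qed.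
Let dual_addN : left_inverse dual_zero dual_opp dual_add.
Proof. by move=> f; apply: dualP => x; exact: addNr. Qed.

HB.instance Definition _ := GRing.isZmodule.Build (dual C M)
  dual_addA dual_addC dual_add0 dual_addN.

Let dual_scaleA l m f : dual_scale l (dual_scale m f) = dual_scale (l * m) f.
Proof. by apply: dualP => x; exact: scalerA. Qed.
Let dual_scale1 : left_id 1 dual_scale.
Proof. by move=> f; apply: dualP => x; exact: scale1r. Qed.
Let dual_scaleDr : right_distributive dual_scale +%R.
Proof. by move=> l f g; apply: dualP => x; exact: scalerDr. Qed.
Let dual_scaleDl f : {morph dual_scale^~ f : l m / l + m}.
Proof. by move=> l m; apply: dualP => x; exact: scalerDl. Qed.

HB.instance Definition _ := GRing.Zmodule_isLmodule.Build Lam (dual C M)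
  dual_scaleA dual_scale1 dual_scaleDr dual_scaleDl.

End Dual.

(* g^dagger : N^dagger -> M^dagger, precomposition with g : M -> N. *)
Section DualMap.
Variables (Lam Gam : pzRingType) (C : bimodType Lam Gam).
Variables (M N : lmodType Gam^c) (g : {linear M -> N}).

Definition dual_map_fun (f : dual C N) : dual C M :=
  (f : {linear N -> right_mod C}) \o g : {linear M -> right_mod C}.

Lemma dual_map_is_linear : linear dual_map_fun.
Proof. by move=> l f h; apply: dualP. Qed.

HB.instance Definition _ :=
  GRing.isLinear.Build Lam (dual C N) (dual C M) _ dual_map_fun
    dual_map_is_linear.

Definition dual_map : {linear dual C N -> dual C M} := dual_map_fun.

End DualMap.

Section Submodule.
Variables (R : pzRingType) (U : lmodType R) (S : submodClosed U).

Definition submodule : Type := {u : U | u \in S}.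

HB.instance Definition _ := SubChoice.on submodule.
HB.instance Definition _ := [SubChoice_isSubLmodule of submodule by <:].

End Submodule.

Section QuotientModule.
Variables (R : pzRingType) (U : lmodType R) (S : submodClosed U).

Local Open Scope quotient_scope.

(* [Quotient.quot] wants a predicate known to be closed under opposites, which
   [submodClosed] does not record. *)
Definition quot_pred : {pred U} := S.

HB.instance Definition _ :=
  GRing.isSubmodClosed.Build R U quot_pred (GRing.subsemimodClosedP S).

Definition quotmod : Type := Quotient.quot quot_pred.

HB.instance Definition _ := GRing.Zmodule.on quotmod.

Let quot_piD : {morph \pi_quotmod : u v / u + v}.
Proof. exact: (raddfD \pi_(Quotient.quot quot_pred)). Qed.

Let quotP (q : quotmod) : exists u, q = \pi_quotmod u.
Proof. by exists (repr q); rewrite [RHS]reprK. Qed.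

Definition quot_scale (a : R) (q : quotmod) : quotmod := \pi_quotmod (a *: repr q).

Let qscale_pi a u :
  quot_scale a (\pi_quotmod u) = \pi_quotmod (a *: u).
Proof.
rewrite /quot_scale; apply/eqP; rewrite -Quotient.idealrBE -scalerBr rpredZ //.
by rewrite Quotient.idealrBE reprK.
Qed.

Let qscaleA a b q : quot_scale a (quot_scale b q) = quot_scale (a * b) q.
Proof. by have [u ->] := quotP q; rewrite !qscale_pi scalerA. Qed.
Let qscale1 : left_id 1 quot_scale.
Proof. by move=> q; have [u ->] := quotP q; rewrite qscale_pi scale1r. Qed.
Let qscaleDr : right_distributive quot_scale +%R.
Proof.
move=> a p q; have [u ->] := quotP p; have [v ->] := quotP q.
by rewrite -quot_piD !qscale_pi scalerDr quot_piD.
Qed.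
Let qscaleDl q : {morph quot_scale^~ q : a b / a + b}.
Proof. by move=> a b; rewrite /quot_scale scalerDl quot_piD. Qed.

HB.instance Definition _ := GRing.Zmodule_isLmodule.Build R quotmod
  qscaleA qscale1 qscaleDr qscaleDl.

Definition quot_proj (u : U) : quotmod := \pi_quotmod u.

Lemma quot_proj_is_linear : linear quot_proj.
Proof. by move=> a u v; rewrite /quot_proj quot_piD -qscale_pi. Qed.

HB.instance Definition _ :=
  GRing.isLinear.Build R U quotmod _ quot_proj quot_proj_is_linear.

Lemma quot_proj_eq0 u : (quot_proj u == 0) = (u \in S).
Proof.
rewrite -[u in RHS]subr0 -[RHS]/(u - 0 \in quot_pred) Quotient.idealrBE.
by rewrite -(linear0 quot_proj).
Qed.

Lemma quot_proj_surj q : exists u, quot_proj u = q.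
Proof. by exists (repr q); exact: reprK. Qed.

End QuotientModule.

Section KernelImage.
Variables (R : pzRingType) (U V : lmodType R) (f : {linear U -> V}).

Definition ker_pred : {pred U} := fun u => f u == 0.

Lemma ker_pred_closed : subsemimod_closed ker_pred.
Proof.
split=> [|a u /eqP fu0]; last by rewrite unfold_in linearZ /= fu0 scaler0.
split=> [|u v /eqP fu0 /eqP fv0]; rewrite unfold_in ?linear0 //.
by rewrite linearD fu0 fv0 addr0.
Qed.

HB.instance Definition _ := GRing.isSubmodClosed.Build R U ker_pred
  ker_pred_closed.

Definition im_pred : {pred V} := fun v => `[< exists u, f u = v >].

Lemma im_pred_closed : subsemimod_closed im_pred.
Proof.
split=> [|a v /asboolP[u <-]]; last first.
  by apply/asboolP; exists (a *: u); rewrite linearZ.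
split=> [|v w /asboolP[u <-] /asboolP[u' <-]]; apply/asboolP.
  by exists 0; rewrite linear0.
by exists (u + u'); rewrite linearD.
Qed.

HB.instance Definition _ := GRing.isSubmodClosed.Build R V im_pred
  im_pred_closed.

Definition ker_mod : lmodType R := submodule ker_pred.
Definition im_mod : lmodType R := submodule im_pred.
Definition coker_mod : lmodType R := quotmod im_pred.

End KernelImage.

(* Ker g / Im f for U -f-> V -g-> W; the image of f is pulled back to Ker g, so
   no proof of g \o f = 0 is needed to form the quotient. *)
Section Homology.
Variables (R : pzRingType) (U V W : lmodType R).
Variables (f : {linear U -> V}) (g : {linear V -> W}).

Definition bound_pred : {pred submodule (ker_pred g)} :=
  fun z => val z \in im_pred f.

Lemma bound_pred_closed : subsemimod_closed bound_pred.
Proof.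
split=> [|a z zB]; last by rewrite unfold_in linearZ rpredZ.
by split=> [|y z yB zB]; rewrite unfold_in ?linear0 ?rpred0 // linearD rpredD.
Qed.

HB.instance Definition _ := GRing.isSubmodClosed.Build R _ bound_pred
  bound_pred_closed.

Definition homology : lmodType R := quotmod bound_pred.

End Homology.

Definition fin_gen (R : pzRingType) (P : lmodType R) : Prop :=
  exists (n : nat) (x : 'I_n -> P),
    forall y : P, exists a : 'I_n -> R, y = \sum_i a i *: x i.

Definition projective (R : pzRingType) (P : lmodType R) : Prop :=
  forall (U V : lmodType R) (g : {linear U -> V}) (f : {linear P -> V}),
    (forall v, exists u, g u = v) ->
    exists h : {linear P -> U}, forall x, g (h x) = f x.

(* [res_diff n] is d_(n+1) : P_(n+1) -> P_n. *)
Record fgproj_resolution (R : pzRingType) (M : lmodType R) := FgprojResolution {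
  res_mod : nat -> lmodType R;
  res_diff : forall n, {linear res_mod n.+1 -> res_mod n};
  res_aug : {linear res_mod 0 -> M};
  res_fin_gen : forall n, fin_gen (res_mod n);
  res_projective : forall n, projective (res_mod n);
  res_aug_surj : forall y, exists x, res_aug x = y;
  res_exact0 : forall x, res_aug x = 0 <-> exists z, res_diff 0 z = x;
  res_exactS : forall n x,
    res_diff n x = 0 <-> exists z, res_diff n.+1 z = x
}.

Section Lambda.
Variables (Lam Gam : pzRingType) (C : bimodType Lam Gam) (M : lmodType Gam^c).
Variable P : fgproj_resolution M.

(* d_(n+1)^dagger : P_n^dagger -> P_(n+1)^dagger *)
Definition codiff (n : nat) :
    {linear dual C (res_mod P n) -> dual C (res_mod P n.+1)} :=
  dual_map C (res_diff P n).

(* Ext^n_Gam(M, C), computed from P *)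
Definition Ext (n : nat) : lmodType Lam :=
  match n with
  | 0 => ker_mod (codiff 0)
  | m.+1 => homology (codiff m) (codiff m.+1)
  end.

Variables (W : lmodType Lam) (lamW : {linear W -> dual C M}).

(* E^i(lambda_W) is defined for i >= 1; the value at 0 is never used. *)
Definition E_mod (i : nat) : lmodType Lam :=
  match i with
  | 0 | 1 => ker_mod lamW
  | 2 => coker_mod lamW
  | j.+2 => Ext j
  end.

Definition O_mod (i : 'I_3) : lmodType Lam :=
  match val i with
  | 0 => coker_mod (codiff 0)
  | 1 => im_mod (codiff 0)
  | _ => W
  end.

(* {0, 1, ...} together with oo is the nonnegative part of [\bar int]. *)
Definition t_inf : \bar int :=
  infimum +oo%E [set (i%:Z)%:E | i in [set i : nat | exists x : E_mod i.+1, x != 0]].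

End Lambda.

Section Depth.
Variable R : pzRingType.
Implicit Types d : lmodType R -> \bar int.

Definition short_exact (K L N : lmodType R)
    (f : {linear K -> L}) (g : {linear L -> N}) : Prop :=
  [/\ injective f, forall z, exists y, g y = z &
      forall y, g y = 0 <-> exists x, f x = y].

Local Open Scope ereal_scope.

Definition nat_or_infty_valued d : Prop := forall N, 0 <= d N.

Definition d1_tilde d : Prop :=
  forall (K L N : lmodType R) (f : {linear K -> L}) (g : {linear L -> N}),
    short_exact f g -> d K < d L -> d N + 1 <= d K.

Definition d3 d : Prop :=
  forall (K L N : lmodType R) (f : {linear K -> L}) (g : {linear L -> N}),
    short_exact f g -> d L < d N -> d K <= d L.

(* D is a direct summand of a finite direct sum of copies of C. *)
Definition summand_of_sum (C D : lmodType R) : Prop :=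
  exists (n : nat) (D' : lmodType R)
         (f : {linear (D * D')%type -> {ffun 'I_n -> C}}), bijective f.

Variables (S : Type) (d : S -> lmodType R -> \bar int).

Definition Xset (i : \bar int) (N : lmodType R) : set S :=
  [set p | i <= d p N].

Definition Yset (C N : lmodType R) : set S := [set p | d p N < d p C].

(* [infimum +oo] and [supremum -oo] are the infimum and supremum in the complete
   order [\bar int]; the extra argument is their value on the empty set. *)
Definition Tinf (U : set S) (N : lmodType R) : \bar int :=
  infimum +oo [set d p N | p in U].

Definition Ssup (C N : lmodType R) : \bar int :=
  supremum -oo [set i%:E | i in
    [set i : int | forall p, Order.min i%:E (d p C) <= d p N]].

End Depth.

(* Main.v *)
(* Condition (d1~) gives d(K) >= min(d(L), d(N) + 1) for every short exact
   sequence 0 -> K -> L -> N -> 0.  Dualizing the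
   resolution gives P_0^dagger -> P_1^dagger -> ..., whose terms are direct
   summands of finite sums of copies of C and which is exact wherever the modules
   E^i(lambda_W) vanish.  Descending along its cokernels, each step raising the
   bound on d by one, yields d (O^i) >= min (t + i - 2, e) as soon as e bounds d
   from below on all summands of finite sums of copies of C.  For d_p, (d3) allows
   e = d_p(C), and (1)-(5) are formal consequences of this inequality. *)

Require Import Defs.
From HB Require Import structures.
From mathcomp Require Import all_boot all_order all_algebra.
From mathcomp Require Import boolp classical_sets constructive_ereal.
From mathcomp Require Import zify.

Set Implicit Arguments.
Unset Strict Implicit.
Unset Printing Implicit Defensive.

Import Order.TTheory GRing.Theory Num.Theory.

Local Open Scope classical_set_scope.
Local Open Scope ring_scope.
Local Open Scope ereal_scope.

Lemma supremums_int_neq0 (A : set (\bar int)) : supremums A !=set0.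
Proof.
have [Aoo|Aoo] := pselect (A +oo).
  by exists +oo; split=> [x _|u]; [exact: leey|exact].
have [[a Aa]|Afin] := pselect (exists a : int, A a%:E); last first.
  exists -oo; split=> [[x| |] Ax|u _]; rewrite ?leNye //.
  by case: Afin; exists x.
have [[b Ab]|Aunbd] := pselect (exists b : int, forall x : int, A x%:E -> (x <= b)%R).
  have exn : exists n : nat, `[< A (b - n%:Z)%:E >].
    exists (absz (b - a)); apply/asboolP.
    by have := Ab a Aa => ?; rewrite (_ : (_ - _)%R = a)//; lia.
  have [n /asboolP An nmin] := ex_minnP exn; exists (b - n%:Z)%:E.
  split=> [[x| |] Ax|u]; rewrite ?leNye //; last exact.
  rewrite lee_fin; have xb := Ab x Ax.
  have /nmin : `[< A (b - (absz (b - x))%:Z)%:E >].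
    by apply/asboolP; rewrite (_ : (_ - _)%R = x)//; lia.
  lia.
exists +oo; split=> [x _|[u| |] Au]; rewrite ?leey //.
  by case: Aunbd; exists u => x /Au; rewrite lee_fin.
by have := Au _ Aa.
Qed.

Lemma infimums_int_neq0 (A : set (\bar int)) : infimums A !=set0.
Proof.
have [s [ubs sub]] := supremums_int_neq0 (lbound A).
by exists s; split=> // x Ax; apply: sub => y; exact.
Qed.

Lemma supremum_intP (A : set (\bar int)) : supremums A (supremum -oo A).
Proof.
rewrite /supremum; case: eqP => [->|_]; first by split=> [|y _]; rewrite ?leNye.
by case: xgetP => // nsup; have [s /nsup] := supremums_int_neq0 A.
Qed.

Lemma infimum_intP (A : set (\bar int)) : infimums A (infimum +oo A).
Proof.
rewrite /infimum; case: eqP => [->|_]; first by split=> [|y _]; rewrite ?leey.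
by case: xgetP => // ninf; have [s /ninf] := infimums_int_neq0 A.
Qed.

Lemma lee_int (x y : \bar int) :
  (forall c : int, c%:E <= x -> c%:E <= y) -> x <= y.
Proof.
case: x => [x|h|_]; rewrite ?leNye //; first by move=> h; exact: h.
case: y h => [y|//|] h; last by have := h 0%R (leey _).
by have := h (y + 1)%R (leey _); rewrite lee_fin; lia.
Qed.

Section Modules.
Variable R : pzRingType.
Implicit Types U V X Y Z : lmodType R.

Lemma linear_factor U V X (f : {linear U -> V}) (g : {linear U -> X}) :
    (forall v, exists u, f u = v) -> (forall u, f u = 0%R -> g u = 0%R) ->
  exists h : {linear V -> X}, forall u, h (f u) = g u.
Proof.
move=> fsurj fg; pose r v := sval (cid (fsurj v)).
have rK v : f (r v) = v by rewrite /r; case: cid.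
have gE u u' : f u = f u' -> g u = g u'.
  move=> fE; apply/eqP; rewrite -subr_eq0 -linearB; apply/eqP/fg.
  by rewrite linearB fE subrr.
have lin : linear (g \o r).
  by move=> a v w /=; rewrite -linearP; apply: gE; rewrite linearP !rK.
pose h : {linear V -> X} := HB.pack_for {linear V -> X} (g \o r)
  (GRing.isLinear.Build R V X _ (g \o r) lin).
by exists h => u; apply: gE; rewrite rK.
Qed.

Lemma linear_inj0 U V (f : {linear U -> V}) :
  (forall u, f u = 0%R -> u = 0%R) -> injective f.
Proof.
move=> f0 u v fE; apply/eqP; rewrite -subr_eq0; apply/eqP/f0.
by rewrite linearB fE subrr.
Qed.

Lemma quot_proj_im U V (f : {linear U -> V}) v :
  quot_proj (im_pred f) v = 0%R <-> exists u, f u = v.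
Proof.
split=> [/eqP|fv]; first by rewrite quot_proj_eq0 => /asboolP.
by apply/eqP; rewrite quot_proj_eq0; apply/asboolP.
Qed.

Lemma short_exact_coker U V (f : {linear U -> V}) :
  injective f -> short_exact f (quot_proj (im_pred f)).
Proof. by split=> //; [exact: quot_proj_surj|exact: quot_proj_im]. Qed.

Lemma short_exact_im U V (f : {linear U -> V}) :
  short_exact (val : {linear im_mod f -> V}) (quot_proj (im_pred f)).
Proof.
split; [exact: val_inj|exact: quot_proj_surj|move=> v].
rewrite quot_proj_im; split=> [fv|[z <-]]; last by have /asboolP := valP z.
have fv' : v \in im_pred f by apply/asboolP.
by exists (Sub v fv'); exact: SubK.
Qed.

Lemma short_exact_coker_coker U V X (f : {linear U -> V}) (g : {linear V -> X}) :
    (forall v, g v = 0%R <-> exists u, f u = v) ->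
  exists h : {linear coker_mod f -> X},
    short_exact h (quot_proj (im_pred g)).
Proof.
move=> ex; have [|u fu0|h hE] := @linear_factor _ _ _ (quot_proj (im_pred f)) g.
- exact: quot_proj_surj.
- by apply/ex; apply/quot_proj_im.
exists h; split=> [|x|x]; last 2 first.
- exact: quot_proj_surj.
- rewrite quot_proj_im; split=> [[v <-]|[q <-]].
    by exists (quot_proj (im_pred f) v); exact: hE.
  by have [v <-] := quot_proj_surj q; exists v; rewrite hE.
apply: linear_inj0 => q; have [v <-] := quot_proj_surj q.
by rewrite hE => /ex fv; apply/quot_proj_im.
Qed.

Lemma homology_exact U V X (f : {linear U -> V}) (g : {linear V -> X}) :
    (forall z : homology f g, z = 0%R) -> (forall u, g (f u) = 0%R) ->
  forall v, g v = 0%R <-> exists u, f u = v.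
Proof.
move=> H0 gf v; split=> [gv|[u <-]//].
have gv' : v \in ker_pred g by apply/eqP.
pose z : submodule (ker_pred g) := Sub v gv'.
have /eqP := H0 (quot_proj (@bound_pred _ _ _ _ f g) z).
by rewrite quot_proj_eq0 unfold_in => /asboolP; rewrite SubK.
Qed.

Lemma retract_summand U V (f : {linear U -> V}) (g : {linear V -> U}) :
    cancel f g ->
  exists (U' : lmodType R) (h : {linear (U * U')%type -> V}), bijective h.
Proof.
move=> fK; exists (ker_mod g).
pose hf (w : U * ker_mod g) : V := (f w.1 + val w.2)%R.
have hl : linear hf.
  move=> a w w'; rewrite /hf /= !linearP /= scalerDr !addrA.
  congr (_ + _)%R; rewrite -!addrA; congr (_ + _)%R; exact: addrC.
pose h : {linear (U * ker_mod g)%type -> V} :=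
  HB.pack_for {linear (U * ker_mod g)%type -> V} hf
    (GRing.isLinear.Build R (U * ker_mod g)%type V _ hf hl).
have kg v : (v - f (g v))%R \in ker_pred g.
  by apply/eqP; rewrite linearB fK subrr.
have gk (z : ker_mod g) : g (val z) = 0%R by apply/eqP; exact: (valP z).
exists h, (fun v => (g v, Sub (v - f (g v))%R (kg v))) => [[u z]|v].
  rewrite /h /= /hf /=; have gE : g (f u + val z)%R = u.
    by rewrite linearD fK gk addr0.
  congr (_, _); first exact: gE.
  apply: val_inj; transitivity (f u + val z - f (g (f u + val z)))%R.
    exact: SubK.
  by rewrite gE addrC addKr.
transitivity (f (g v) + (v - f (g v)))%R; last by rewrite addrC subrK.
by congr (_ + _)%R; exact: SubK.
Qed.

End Modules.

Section Depth.
Variables (R : pzRingType) (d : lmodType R -> \bar int).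
Hypothesis d1 : d1_tilde d.
Implicit Types K L N : lmodType R.

Lemma depth_sub K L N (f : {linear K -> L}) (g : {linear L -> N}) c :
  short_exact f g -> c <= d L -> c <= d N + 1 -> c <= d K.
Proof.
move=> fg cL cN; have [LK|KL] := leP (d L) (d K); first exact: le_trans LK.
exact: le_trans cN (d1 fg KL).
Qed.

Lemma depth_trivial K L : (forall x : K, x = 0%R) -> d L <= d K.
Proof.
move=> K0; have ex : short_exact (\0 : {linear K -> L}) (idfun : {linear L -> L}).
  split=> [x y _|y|y]; first by rewrite (K0 x) (K0 y).
    by exists y.
  by split=> [y0|[x <-]]; [exists 0%R|].
rewrite leNgt; apply/negP => KL.
by have := le_lt_trans (d1 ex KL) KL; rewrite ltNge leeDl.
Qed.

Lemma depth_iso K L (f : {linear K -> L}) : bijective f -> d L <= d K.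
Proof.
move=> /[dup] /bij_inj finj [f' _ f'K].
have Z0 (x : {ffun 'I_0 -> K}) : x = 0%R by apply/ffunP => -[].
apply: (@depth_sub K L {ffun 'I_0 -> K} f \0).
- split=> // [z|y]; first by exists 0%R; rewrite (Z0 z).
  by split=> // _; exists (f' y).
- exact: lexx.
- by apply: le_trans (depth_trivial L Z0) _; rewrite leeDl.
Qed.

Hypothesis d0 : nat_or_infty_valued d.

Lemma depth_summand K L : d (K * L)%type <= d K.
Proof.
have inl : linear (fun x : K => (x, 0%R) : (K * L)%type).
  by move=> a x y; congr (_, _); rewrite /= scaler0 addr0.
have inr : linear (fun x : L => (0%R, x) : (K * L)%type).
  by move=> a x y; congr (_, _); rewrite /= scaler0 addr0.
pose il : {linear K -> (K * L)%type} := HB.pack_for {linear K -> (K * L)%type}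
  (fun x : K => (x, 0%R) : (K * L)%type) (GRing.isLinear.Build _ _ _ _ _ inl).
pose ir : {linear L -> (K * L)%type} := HB.pack_for {linear L -> (K * L)%type}
  (fun x : L => (0%R, x) : (K * L)%type) (GRing.isLinear.Build _ _ _ _ _ inr).
have sl : short_exact il (snd : {linear (K * L)%type -> L}).
  split=> [x y [->]//|z|[x y] /=]; first by exists (0%R, z).
  by split=> [->|[z [_ <-]]//]; exists x.
have sr : short_exact ir (fst : {linear (K * L)%type -> K}).
  split=> [x y [->]//|z|[x y] /=]; first by exists (z, 0%R).
  by split=> [->|[z [<- _]]//]; exists y.
rewrite leNgt; apply/negP => KKL.
(* [d1_tilde] on the two split sequences: d K >= d L + 1 and d L >= d K + 1. *)
have LK := d1 sl KKL.
have LK' : d L <= d K by apply: le_trans LK; rewrite leeDl.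
have KL := d1 sr (le_lt_trans LK' KKL).
move: KKL LK KL (d0 K).
case: (d K) (d L) (d (K * L)%type) => [k| |] [l| |] [m| |] //=.
all: rewrite -?EFinD ?lee_fin ?lte_fin; try lia; by [].
Qed.

Hypothesis d3d : d3 d.

Lemma depth_power K n : d K <= d {ffun 'I_n -> K}.
Proof.
elim: n => [|n IHn]; first by apply: depth_trivial => x; apply/ffunP => -[].
pose inf (x : K) := [ffun i : 'I_n.+1 => if i == ord0 then x else 0%R].
have inl : linear inf.
  move=> a x y; apply/ffunP => i; rewrite !ffunE.
  by case: eqP => // _; rewrite scaler0 addr0.
pose prf (u : {ffun 'I_n.+1 -> K}) := [ffun i : 'I_n => u (lift ord0 i)].
have prl : linear prf by move=> a x y; apply/ffunP => i; rewrite !ffunE.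
pose f : {linear K -> {ffun 'I_n.+1 -> K}} :=
  HB.pack_for {linear K -> {ffun 'I_n.+1 -> K}} inf
    (GRing.isLinear.Build _ _ _ _ _ inl).
pose g : {linear {ffun 'I_n.+1 -> K} -> {ffun 'I_n -> K}} :=
  HB.pack_for {linear {ffun 'I_n.+1 -> K} -> {ffun 'I_n -> K}} prf
    (GRing.isLinear.Build _ _ _ _ _ prl).
have fg : short_exact f g.
  split=> [x y /ffunP/(_ ord0)|z|u]; first by rewrite !ffunE.
    exists [ffun i => if unlift ord0 i is Some j then z j else 0%R].
    by apply/ffunP => i; rewrite !ffunE liftK.
  split=> [/ffunP u0|[x <-]]; last by apply/ffunP => i; rewrite !ffunE.
  exists (u ord0); apply/ffunP => i; rewrite !ffunE.
  case: (unliftP ord0 i) => [j|] -> //.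
  by have := u0 j; rewrite !ffunE.
rewrite leNgt; apply/negP => LK.
by have := le_lt_trans (d3d fg (lt_le_trans LK IHn)) LK; rewrite ltxx.
Qed.

Lemma depth_summand_of_sum K L : summand_of_sum K L -> d K <= d L.
Proof.
move=> [n [L' [f fbij]]]; apply: le_trans (depth_summand L L').
exact: le_trans (depth_power K n) (depth_iso fbij).
Qed.

End Depth.

Section Dual.
Variables (Lam Gam : pzRingType) (C : bimodType Lam Gam).

Lemma dual_summand (P : lmodType Gam^c) :
  fin_gen P -> projective P -> summand_of_sum C (dual C P).
Proof.
move=> [n [x xgen]] Pproj.
pose F := {ffun 'I_n -> (Gam^c)^o}.
pose pif (a : F) := (\sum_i (a i : Gam^c) *: x i)%R.
have pil : linear pif.
  move=> a u v; rewrite /pif scaler_sumr -big_split; apply: eq_bigr => i _ /=.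
  by rewrite !ffunE scalerA -scalerDl.
pose pi : {linear F -> P} :=
  HB.pack_for {linear F -> P} pif (GRing.isLinear.Build _ _ _ _ _ pil).
have [|s sK] := Pproj F P pi idfun.
  move=> y; have [a ->] := xgen y; exists [ffun i => a i].
  by apply: eq_bigr => i _; rewrite ffunE.
pose bf (c : {ffun 'I_n -> C}) (y : P) : right_mod C :=
  (\sum_i (s y i : Gam^c) *: (c i : right_mod C))%R.
have bfl c : linear (bf c).
  move=> a u v; rewrite /bf scaler_sumr -big_split; apply: eq_bigr => i _ /=.
  by rewrite linearP !ffunE scalerA -scalerDl.
pose b c : dual C P := (HB.pack_for {linear P -> right_mod C} (bf c)
  (GRing.isLinear.Build _ _ _ _ _ (bfl c)) : {linear P -> right_mod C}).
have bl : linear b.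
  move=> l u v; apply: dualP => y; rewrite /dual_apply /= /bf.
  transitivity (l *: ((\sum_i (s y i : Gam^c) *: (u i : right_mod C))%R : C)
     + (\sum_i (s y i : Gam^c) *: (v i : right_mod C))%R : C)%R; last by [].
  rewrite scaler_sumr -big_split; apply: eq_bigr => i _ /=.
  rewrite !ffunE scalerDr; congr (_ + _)%R; exact: ract_scaleA.
pose af (phi : dual C P) : {ffun 'I_n -> C} := [ffun i => dual_apply phi (x i)].
have al : linear af by move=> l u v; apply/ffunP => i; rewrite !ffunE.
pose alpha : {linear dual C P -> {ffun 'I_n -> C}} :=
  HB.pack_for {linear dual C P -> {ffun 'I_n -> C}} af
    (GRing.isLinear.Build _ _ _ _ _ al).
pose beta : {linear {ffun 'I_n -> C} -> dual C P} :=
  HB.pack_for {linear {ffun 'I_n -> C} -> dual C P} b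
    (GRing.isLinear.Build _ _ _ _ _ bl).
have alphaK : cancel alpha beta.
  move=> phi; apply: dualP => y; rewrite /dual_apply /= /bf.
  have sKy : pi (s y) = y := sK y.
  rewrite -[in RHS]sKy /= /pif raddf_sum; apply: eq_bigr => i _ /=.
  by rewrite ffunE linearZ.
by have [D' [h hbij]] := retract_summand alphaK; exists n, D', h.
Qed.

Variables (M : lmodType Gam^c) (P : fgproj_resolution M).

Lemma codiff_codiff n phi : codiff C P n.+1 (codiff C P n phi) = 0%R.
Proof.
apply: dualP => x; rewrite /dual_apply /=.
have -> : res_diff P n (res_diff P n.+1 x) = 0%R by apply/res_exactS; exists x.
exact: linear0.
Qed.

Lemma Ext_exact n : (forall z : Ext C P n.+1, z = 0%R) ->
  forall phi, codiff C P n.+1 phi = 0%R <-> exists psi, codiff C P n psi = phi.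
Proof. by move/homology_exact; apply; exact: codiff_codiff. Qed.

Lemma codiff0_exact phi :
  codiff C P 0 phi = 0%R <-> exists psi, dual_map C (res_aug P) psi = phi.
Proof.
split=> [phi0|[psi <-]]; last first.
  apply: dualP => x; rewrite /dual_apply /=.
  have -> : res_aug P (res_diff P 0 x) = 0%R by apply/res_exact0; exists x.
  exact: linear0.
have [|x /res_exact0[z <-]|psi psiE] := @linear_factor _ _ _ _ (res_aug P)
  (phi : {linear res_mod P 0 -> right_mod C}).
- exact: res_aug_surj.
- by have := congr1 (fun f => dual_apply f z) phi0.
by exists psi; apply: dualP => x; exact: psiE.
Qed.

Lemma dual_aug_inj : injective (dual_map C (res_aug P)).
Proof.
move=> phi psi e; apply: dualP => y; have [x <-] := res_aug_surj P y.
exact: (congr1 (fun f => dual_apply f x) e).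
Qed.

Variables (W : lmodType Lam) (lamW : {linear W -> dual C M}).

Lemma t_inf_ge0 : 0 <= t_inf P lamW.
Proof.
have [_ glb] := infimum_intP [set (i%:Z)%:E |
  i in [set i : nat | exists x : E_mod P lamW i.+1, x != 0%R]].
by apply: glb => _ [i _ <-]; rewrite lee_fin.
Qed.

Lemma E_mod_eq0 (j : nat) :
  j%:Z%:E < t_inf P lamW -> forall x : E_mod P lamW j.+1, x = 0%R.
Proof.
move=> jt x; apply/eqP/negPn/negP => x0; move: jt; rewrite ltNge => /negP; apply.
have [lb _] := infimum_intP [set (i%:Z)%:E |
  i in [set i : nat | exists x : E_mod P lamW i.+1, x != 0%R]].
by apply: lb; exists j => //; exists x.
Qed.

Lemma E_mod_inj : 0 < t_inf P lamW -> injective lamW.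
Proof.
move=> /(@E_mod_eq0 0) E1; apply: linear_inj0 => w lw.
have w0 : w \in ker_pred lamW by apply/eqP.
by have := congr1 val (E1 (Sub w w0)); rewrite SubK.
Qed.

Lemma E_mod_surj : 1 < t_inf P lamW -> forall y, exists w, lamW w = y.
Proof. by move=> /(@E_mod_eq0 1) E2 y; apply/quot_proj_im; exact: E2. Qed.

Variable d : lmodType Lam -> \bar int.
Hypothesis (d0 : nat_or_infty_valued d) (d1 : d1_tilde d).

Lemma depth_coker_codiff (c : int) (n k : nat) :
    (forall j, c%:E <= d (dual C (res_mod P j))) ->
    (forall j, (n <= j < n + k)%N -> forall z : Ext C P j.+1, z = 0%R) ->
  (c <= k%:Z)%R -> c%:E <= d (coker_mod (codiff C P n)).
Proof.
elim: k c n => [|k IHk] c n cP ext0 ck.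
  by apply: le_trans (d0 _); rewrite lee_fin.
have [h hex] := short_exact_coker_coker (Ext_exact (ext0 n ltac:(lia))).
apply: (depth_sub d1 hex); first exact: cP.
have : (c - 1)%:E <= d (coker_mod (codiff C P n.+1)).
  apply: IHk; [move=> j|move=> j ?; apply: ext0; lia|lia].
  by apply: le_trans (cP j); rewrite lee_fin; lia.
by move/(leeD2r 1); rewrite -EFinD subrK.
Qed.

Lemma depth_O_mod (c : int) (i : 'I_3) :
    (forall C'' : lmodType Lam, summand_of_sum C C'' -> c%:E <= d C'') ->
  c%:E <= t_inf P lamW + (i%:Z - 2)%:E -> c%:E <= d (O_mod C P W i).
Proof.
move=> cC ct; have [c0|c0] := lerP c 0.
  by apply: le_trans (d0 _); rewrite lee_fin.
have cP j : c%:E <= d (dual C (res_mod P j)).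
  by apply/cC/dual_summand; [exact: res_fin_gen|exact: res_projective].
have lt_t (j : nat) : (j%:Z < c - i%:Z + 2)%R -> j%:Z%:E < t_inf P lamW.
  by case: (t_inf P lamW) ct => [t| |//]; rewrite ?lte_fin ?ltey // lee_fin; lia.
have decr (x : int) N : (x - 1)%:E <= d N -> x%:E <= d N + 1.
  by move/(leeD2r 1); rewrite -EFinD subrK.
have coker0 (x : int) : (x <= c - i%:Z)%R ->
    x%:E <= d (coker_mod (codiff C P 0)).
  have [x0 _|x0 xi] := lerP x 0; first by apply: le_trans (d0 _); rewrite lee_fin.
  apply: (@depth_coker_codiff _ _ (absz x)); last lia.
    by move=> j; apply: le_trans (cP j); rewrite lee_fin; lia.
  by move=> j /andP[_ jx]; apply: (@E_mod_eq0 j.+2); apply: lt_t; lia.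
case: i ct lt_t coker0 => [[|[|[|i]]] i3] //= ct lt_t coker0.
- by apply: coker0; lia.
- by apply: (depth_sub d1 (short_exact_im _)); [exact: cP|apply/decr/coker0; lia].
pose e : {linear W -> dual C (res_mod P 0)} := dual_map C (res_aug P) \o lamW.
have einj : injective e.
  by apply: inj_comp; [exact: dual_aug_inj|apply/E_mod_inj/(lt_t 0%N); lia].
apply: (depth_sub d1 (short_exact_coker einj)); [exact: cP|apply/decr].
have [c1|c1] := lerP c 1.
  by apply: le_trans (d0 _); rewrite lee_fin; lia.
have eex v : codiff C P 0 v = 0%R <-> exists u, e u = v.
  rewrite codiff0_exact; split=> [[psi <-]|[w <-]]; last by exists (lamW w).
  by have [|w <-] := E_mod_surj _ psi; [apply: (lt_t 1%N); lia|exists w].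
have [h hex] := short_exact_coker_coker eex.
apply: (depth_sub d1 hex); last by apply/decr/coker0; lia.
by apply: le_trans (cP 1%N); rewrite lee_fin; lia.
Qed.

Lemma depth_O_mod_min (i : 'I_3) (e : \bar int) :
    (forall C'' : lmodType Lam, summand_of_sum C C'' -> e <= d C'') ->
  Order.min (t_inf P lamW + (i%:Z - 2)%:E) e <= d (O_mod C P W i).
Proof.
move=> eC; apply: lee_int => c; rewrite le_min => /andP[ct ce].
by apply: depth_O_mod ct => C'' /eC; exact: le_trans.
Qed.

End Dual.

Theorem proposition2p3
  (Lam Gam : pzRingType) (C : bimodType Lam Gam) (M : lmodType Gam^c)
  (P : fgproj_resolution M)
  (W : lmodType Lam) (lamW : {linear W -> dual C M})
  (S : Type) (d : S -> lmodType Lam -> \bar int)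
  (S_nonempty : inhabited S)
  (d_val : forall p, nat_or_infty_valued (d p))
  (d_d1 : forall p, d1_tilde (d p))
  (d_d3 : forall p, d3 (d p))
  (C' : lmodType Lam) (C'_summand : summand_of_sum C C') :
  let t := t_inf P lamW in
  let O_ := O_mod C P W in
  [/\ (forall i : int, i%:E <= Tinf d (Xset d i%:E C) C')
      /\ Ssup d C C' = +oo,
      forall (i : 'I_3) (d' : lmodType Lam -> \bar int),
        nat_or_infty_valued d' -> d1_tilde d' ->
        (forall C'' : lmodType Lam, summand_of_sum C C'' ->
           t + (i%:Z - 1)%:E <= d' C'') ->
        t + (i%:Z - 2)%:E <= d' (O_ i),
      forall i : 'I_3, Yset d C (O_ i) `<=` Xset d (t + (i%:Z - 1)%:E) C,
      forall i : 'I_3,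
        t + (i%:Z - 2)%:E <= Tinf d (Xset d (t + (i%:Z - 1)%:E) C) (O_ i)
        /\ Tinf d (Xset d (t + (i%:Z - 1)%:E) C) (O_ i) <= Ssup d C (O_ i)
    & forall i : 'I_3,
        t + (i%:Z - 2)%:E = Tinf d (Xset d (t + (i%:Z - 1)%:E) C) (O_ i)
        <-> t + (i%:Z - 2)%:E = Ssup d C (O_ i)].
Proof.
move=> t O_; have t0 : 0 <= t := t_inf_ge0 P lamW.
have dC C'' p : summand_of_sum C C'' -> d p C <= d p C''.
  exact: depth_summand_of_sum.
have le_t21 (i : 'I_3) : t + (i%:Z - 2)%:E <= t + (i%:Z - 1)%:E.
  by apply: leeD2l; rewrite lee_fin; lia.
have dO (i : 'I_3) p : Order.min (t + (i%:Z - 2)%:E) (d p C) <= d p (O_ i).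
  by apply: depth_O_mod_min => // C''; exact: dC.
have YX (i : 'I_3) : Yset d C (O_ i) `<=` Xset d (t + (i%:Z - 1)%:E) C.
  move=> p; rewrite /Yset /Xset /= => OC; have := dO i p.
  rewrite ge_min (leNgt (d p C)) OC orbF => tO; have := le_lt_trans tO OC.
  case: (t) (d p C) t0 => [s| |] [c| |] //= _; rewrite -!EFinD ?leey //.
  by rewrite lte_fin lee_fin; lia.
have tT (i : 'I_3) :
    t + (i%:Z - 2)%:E <= Tinf d (Xset d (t + (i%:Z - 1)%:E) C) (O_ i).
  have [_ glb] := infimum_intP [set d p (O_ i) | p in Xset d (t + (i%:Z - 1)%:E) C].
  apply: glb => _ [p pX <-]; apply: le_trans (dO i p).
  by rewrite le_min lexx; exact: le_trans pX.
have TS (i : 'I_3) :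
    Tinf d (Xset d (t + (i%:Z - 1)%:E) C) (O_ i) <= Ssup d C (O_ i).
  have [lb _] := infimum_intP [set d p (O_ i) | p in Xset d (t + (i%:Z - 1)%:E) C].
  have [ub _] := supremum_intP [set j%:E | j in
    [set j : int | forall p, Order.min j%:E (d p C) <= d p (O_ i)]].
  apply: lee_int => j jT; apply: ub; exists j => // p; rewrite ge_min.
  have [/YX pX|] := ltP (d p (O_ i)) (d p C); last by rewrite orbT.
  by rewrite (le_trans jT)//; apply: lb; exists p.
split=> //; first split.
- move=> j; have [_ glb] := infimum_intP [set d p C' | p in Xset d j%:E C].
  by apply: glb => _ [p pX <-]; apply: le_trans pX _; exact: dC.
- apply/eqP; rewrite -leye_eq; apply: lee_int => j _.
  have [ub _] := supremum_intP [set j%:E | j in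
    [set j : int | forall p, Order.min j%:E (d p C) <= d p C']].
  by apply: ub; exists j => // p; rewrite ge_min dC ?orbT.
- move=> i d' d'0 d'1 d'C; apply: le_trans (depth_O_mod_min P lamW d'0 d'1 i d'C).
  by rewrite le_min lexx le_t21.
move=> i; split=> [tE|tS]; last first.
  by apply/eqP; rewrite eq_le tT tS TS.
apply/eqP; rewrite eq_le [X in X <= _]tE TS /=.
have [_ lub] := supremum_intP [set j%:E | j in
  [set j : int | forall p, Order.min j%:E (d p C) <= d p (O_ i)]].
have [_ glb] := infimum_intP [set d p (O_ i) | p in Xset d (t + (i%:Z - 1)%:E) C].
apply: lub => _ [j jS <-]; rewrite leNgt; apply/negP => tj.
(* An integer [j > t + i - 2] in the set defining [Ssup] gives
   [t + i - 1 <= d p (O_ i)] for all [p] in [X_{t+i-1}(C)], against [T = t + i - 2]. *)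
have : t + (i%:Z - 1)%:E <= t + (i%:Z - 2)%:E.
  rewrite [X in _ <= X]tE; apply: glb => _ [p pX <-]; apply: le_trans (jS p).
  rewrite le_min [X in _ && X]pX andbT.
  by case: (t) t0 tj => [s| |] //= _; rewrite -!EFinD lte_fin lee_fin; lia.
by case: (t) t0 tj => [s| |] //= _; rewrite -!EFinD lte_fin lee_fin; lia.
Qed.
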